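(* Let $H$ be a connected rooted graph on $h\ge 1$ vertices with root $o$, let $G$ be any graph, let $\Delta\ge 0$ be a real number, and let $\boldsymbol\alpha=(\alpha_w)_{w\in V(H)}$ be a vector of non-negative real numbers indexed by the vertices of $H$. Put $|\boldsymbol\alpha|:=\sum_{w\in V(H)}\alpha_w$ and $$\hom_{\Delta,\boldsymbol\alpha}(H,G):=\sum_{\varphi\in \operatorname{Hom}(H,G)}\mathbf 1_{\{d_{\varphi(o)}\ge\Delta\}}\prod_{w\in V(H)}d_{\varphi(w)}^{\,\alpha_w},$$ where $\operatorname{Hom}(H,G)$ is the set of homomorphisms $H\to G$ and $d_v$ denotes the degree of a vertex $v$ in $G$. Then $$\hom_{\Delta,\boldsymbol\alpha}(H,G)\le\sum_{v\in V(G)} d_v^{\,h-1+|\boldsymbol\alpha|}\,\mathbf 1_{\{d_v\ge\Delta\}}.$$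
   Context: Graphs are finite and simple (undirected, without loops or multiple edges). A homomorphism $H\to G$ is a map $V(H)\to V(G)$ sending adjacent vertices to adjacent vertices. A rooted graph is a graph with a distinguished vertex, its root. $\mathbf 1_{\{\cdot\}}$ is the indicator. Convention: $0^0=1$. *)

(* Defs.v *)
From mathcomp Require Import all_boot all_order all_algebra.
From mathcomp Require Import reals exp.

Set Implicit Arguments.
Unset Strict Implicit.
Unset Printing Implicit Defensive.

Import Order.TTheory GRing.Theory Num.Theory.
Local Open Scope ring_scope.

Record sgraph := SGraph {
  vertex :> finType;
  adj : rel vertex;
  adj_sym : symmetric adj;
  adj_irr : irreflexive adj }.

Definition deg (G : sgraph) (v : G) : nat := #|[set u : G | adj v u]|.

(* Without a nonemptiness clause: a rooted graph has a vertex. *)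
Definition connected_graph (G : sgraph) : Prop :=
  forall x y : G, connect (@adj G) x y.

Definition graph_hom (H G : sgraph) : {set {ffun H -> G}} :=
  [set phi : {ffun H -> G} |
     [forall x, forall y, adj x y ==> adj (phi x) (phi y)]].

(* The real power [powR] satisfies 0 `^ 0 = 1 and 0 `^ a = 0 for a != 0. *)
Definition hom_weight (R : realType) (H : sgraph) (o : H) (G : sgraph)
    (Delta : R) (alpha : H -> R) : R :=
  \sum_(phi in graph_hom H G)
     (Delta <= (deg (phi o))%:R)%R%:R *
     \prod_(w : H) (deg (phi w))%:R `^ alpha w.

(* Main.v *)
(* More generally, for nonnegative nondecreasing weights [F w],
     sum_phi prod_w F w (deg (phi w)) <= sum_v (deg v)^(h-1) prod_w F w (deg v).
   Both sides are multilinear in the [F w], and each [F w] is a nonnegative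
   combination of threshold indicators, so one may take indicators and keep
   only the weight with the largest threshold, at a vertex [w] say. A vertex
   [l != w] whose deletion leaves [H] connected then carries no weight: summing
   over its images costs at most the degree of the image of a neighbour of [l].
   That degree is again a nondecreasing weight, now on [H - l], which closes an
   induction on the number of vertices. *)
Require Import Defs.
From mathcomp Require Import all_boot all_order all_algebra.
From mathcomp Require Import reals exp.

Set Implicit Arguments.
Unset Strict Implicit.
Unset Printing Implicit Defensive.

Import Order.TTheory GRing.Theory Num.Theory.
Local Open Scope ring_scope.

(** * Nonnegative nondecreasing weights on degrees and their threshold indicators *)

Section Weights.
Context {R : numDomainType}.
Implicit Types f g : nat -> R.

Definition nneg_homo f : Prop :=
  0 <= f 0%N /\ {homo f : m n / (m <= n)%N >-> m <= n}.

Lemma nneg_homo_ge0 f n : nneg_homo f -> 0 <= f n.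
Proof. by case=> f0 fh; apply: le_trans f0 (fh _ _ (leq0n n)). Qed.

Lemma nneg_homo_mul f g :
  nneg_homo f -> nneg_homo g -> nneg_homo (fun n => f n * g n).
Proof.
move=> hf hg; split; first by rewrite mulr_ge0 ?nneg_homo_ge0.
move=> m n le_mn; rewrite ler_pM ?nneg_homo_ge0 //.
  by case: hf => _; apply.
by case: hg => _; apply.
Qed.

Lemma nneg_homo_cst1 : nneg_homo (fun=> 1).
Proof. by split=> // *; exact: ler01. Qed.

Lemma nneg_homo_natr : nneg_homo (fun n => n%:R).
Proof. by split=> // m n; rewrite ler_nat. Qed.

Lemma nneg_homo_leq t : nneg_homo (fun n => (t <= n)%N%:R).
Proof.
split=> [|m n le_mn]; first exact: ler0n.
rewrite ler_nat; case: (leqP t m) => // le_tm.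
by rewrite (leq_trans le_tm le_mn).
Qed.

(** Increments of [f], extended by 0 below 0: the coefficients of the threshold indicators. The
    value at 0 is nonnegative because [f 0] is. *)
Definition layer f (t : nat) : R := f t - (if t is t'.+1 then f t' else 0).

Lemma layer_ge0 f t : nneg_homo f -> 0 <= layer f t.
Proof.
by rewrite /layer; case: t => [|t] [f0 fh]; rewrite ?subr0 // subr_ge0 fh.
Qed.

Lemma layer_cake f N d : (d < N)%N ->
  f d = \sum_(t < N) layer f t * (t <= d)%N%:R.
Proof.
move=> lt_dN; under eq_bigr do rewrite mulr_natr mulrb.
rewrite -big_mkcond -(big_ord_widen N (layer f) lt_dN).
elim: d {lt_dN} => [|d IHd]; first by rewrite big_ord1 /layer subr0.
by rewrite big_ord_recr /= -IHd /layer addrC subrK.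
Qed.

End Weights.

(** * Vertex deletion and non-cut vertices *)

Section DeleteVertex.
Variables (H : sgraph) (l : H).

Definition delete_adj : rel {x : H | x != l} :=
  fun x y => adj (val x) (val y).

Lemma delete_adj_sym : symmetric delete_adj.
Proof. by move=> x y; rewrite /delete_adj adj_sym. Qed.

Lemma delete_adj_irr : irreflexive delete_adj.
Proof. by move=> x; rewrite /delete_adj adj_irr. Qed.

Definition delete_vertex : sgraph := SGraph delete_adj_sym delete_adj_irr.

Lemma card_delete_vertex : #|delete_vertex| = #|H|.-1.
Proof. by rewrite card_sig -(cardC1 l). Qed.

End DeleteVertex.

Section NonCutVertex.
Variable H : sgraph.

Definition induced (S : {set H}) : rel H :=
  fun x y => [&& adj x y, x \in S & y \in S].

Lemma boundary_edge (S : {set H}) w z : connected_graph H ->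
  w \in S -> z \notin S -> exists x y, [/\ adj x y, x \in S & y \notin S].
Proof.
move=> cH wS zNS.
have [/existsP[x /existsP[y /and3P[*]]]|noedge] :=
  boolP [exists x, exists y, [&& adj x y, x \in S & y \notin S]].
  by exists x, y.
have clS : closed (@adj H) S.
  apply: intro_closed; first exact/sym_connect_sym/adj_sym.
  move=> x y xy xS; apply/negPn/negP => yNS.
  by case/negP: noedge; apply/existsP; exists x; apply/existsP; exists y;
     rewrite xy xS.
by rewrite -(closed_connect clS (cH w z)) wS in zNS.
Qed.

(** Take a maximal proper set [S] containing [w] all of whose points are reached from [w] inside
    [S]. An edge leaves [S], to [l] say; adding [l] keeps reachability, so by maximality [S] is
    everything but [l]. *)
Lemma non_cut_vertex w : connected_graph H -> (1 < #|H|)%N ->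
  exists2 l : H, l != w & connected_graph (delete_vertex l).
Proof.
move=> cH H_gt1.
pose P (S : {set H}) :=
  [&& w \in S, S != setT & [forall x in S, connect (induced S) w x]].
have P1 : P [set w].
  rewrite /P set11 /=; apply/andP; split.
    by apply/eqP => e; move: H_gt1; rewrite -cardsT -e cards1.
  by apply/forall_inP => x /set1P ->; exact: connect0.
have [S /maxsetP[/and3P[wS SnT /forall_inP reachS] maxS] _] := maxset_exists P1.
have /existsP[z zNS] : [exists z, z \notin S].
  by rewrite -negb_forall; apply: contra SnT => /forallP allS;
     apply/eqP/setP => z; rewrite inE; exact: allS.
have [x [l [xl xS lNS]]] := boundary_edge cH wS zNS.
have sub_lS : subrel (connect (induced S)) (connect (induced (l |: S))).
  apply: connect_sub => a b /and3P[ab aS bS]; apply: connect1.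
  by rewrite /induced ab !inE aS bS !orbT.
have SlT : l |: S = setT.
  apply/eqP/negPn/negP => lSnT.
  suff: P (l |: S).
    move/maxS => /(_ (subsetUr _ _)) e.
    by rewrite -e setU11 in lNS.
  rewrite /P setU1r //= lSnT; apply/forall_inP => y.
  case/setU1P => [->|yS]; last exact/sub_lS/reachS.
  apply: connect_trans (sub_lS _ _ (reachS x xS)) _; apply: connect1.
  by rewrite /induced xl setU11 setU1r.
have SE y : (y \in S) = (y != l).
  have := in_setT y; rewrite -SlT in_setU1.
  by case: eqP => [->|] //; rewrite (negbTE lNS).
have wl : w != l by rewrite -SE.
exists l; first by rewrite eq_sym.
have reach (y : delete_vertex l) :
    connect (@adj (delete_vertex l)) (exist _ w wl : delete_vertex l) y.
  have yS : val y \in S by rewrite SE (valP y).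
  have /connectP[p] := reachS _ yS.
  (* The path inside [S] is lifted vertex by vertex; writing its start as a [val] lets the induction
     move it. *)
  set a : delete_vertex l := exist _ w wl.
  rewrite -[w]/(val a); elim: p a => [|b p IHp] a /=.
    by move=> _ /val_inj ->.
  case/andP => /and3P[ab _ bS] pathp lastp; rewrite SE in bS.
  apply: (@connect_trans _ _ (exist _ b bS : delete_vertex l)).
    exact: connect1.
  exact: IHp.
have symd : connect_sym (@adj (delete_vertex l)).
  exact/sym_connect_sym/adj_sym.
by move=> a b; apply: connect_trans (reach b); rewrite symd.
Qed.

End NonCutVertex.

(** * The weighted bound, by induction on the number of vertices *)

Section HomWeights.
Context {R : numDomainType}.
Variable G : sgraph.

Lemma deg_lt (v : G) : (deg v < #|G|.+1)%N.
Proof. by rewrite ltnS max_card. Qed.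

(** Group the homomorphisms by their restriction [psi]. Within a fibre the image of [l] determines
    the map and must be a neighbour of [psi p], so the fibre has at most [deg (psi p)] elements. *)
Lemma hom_sum_delete (H : sgraph) (l : H) (p : delete_vertex l)
    (g : {ffun delete_vertex l -> G} -> R) :
  adj l (val p) -> (forall psi, 0 <= g psi) ->
  \sum_(phi in graph_hom H G) g [ffun x => phi (val x)] <=
  \sum_(psi in graph_hom (delete_vertex l) G) g psi * (deg (psi p))%:R.
Proof.
move=> lp g_ge0.
pose res (phi : {ffun H -> G}) : {ffun delete_vertex l -> G} :=
  [ffun x => phi (val x)].
rewrite (partition_big res [in graph_hom (delete_vertex l) G]) /=; last first.
  move=> phi; rewrite !inE => /forallP hphi.
  apply/forallP => x; apply/forallP => y; rewrite !ffunE.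
  by have /forallP /(_ (val y)) := hphi (val x).
apply: ler_sum => psi _.
under eq_bigr => phi /andP[_ /eqP e] do rewrite -/(res phi) e.
rewrite sumr_const -[leLHS]mulr_natr ler_wpM2l // ler_nat.
set A := (X in (#|X| <= _)%N).
have inj : {in A &, injective (fun phi : {ffun H -> G} => phi l)}.
  move=> phi1 phi2 /andP[_ /eqP e1] /andP[_ /eqP e2] e; apply/ffunP => x.
  have [->//|xl] := eqVneq x l.
  have := congr1 (fun f : {ffun delete_vertex l -> G} => f (exist _ x xl))
            (etrans e1 (esym e2)).
  by rewrite !ffunE.
rewrite -(card_in_imset inj); apply/subset_leq_card/subsetP => u.
case/imsetP => phi /andP[hom_phi /eqP <-] ->; rewrite inE ffunE adj_sym.
have /forallP hphi : [forall x, forall y, adj x y ==> adj (phi x) (phi y)].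
  by rewrite inE in hom_phi.
by have /forallP /(_ (val p)) /implyP /(_ lp) := hphi l.
Qed.

(** Here [n] is the number of vertices minus one. [H] and the weights are quantified inside because
    the induction changes both, while [G] stays fixed. *)
Definition single_weight_bound (n : nat) : Prop :=
  forall (H : sgraph) (w : H) (f : nat -> R),
    connected_graph H -> #|H| = n.+1 -> nneg_homo f ->
    \sum_(phi in graph_hom H G) f (deg (phi w)) <=
    \sum_(v : G) (deg v)%:R ^+ n * f (deg v).

Definition all_weights_bound (n : nat) : Prop :=
  forall (H : sgraph) (F : H -> nat -> R),
    connected_graph H -> #|H| = n.+1 -> (forall w, nneg_homo (F w)) ->
    \sum_(phi in graph_hom H G) \prod_(w : H) F w (deg (phi w)) <=
    \sum_(v : G) (deg v)%:R ^+ n * \prod_(w : H) F w (deg v).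

Lemma single_weight_bound0 : single_weight_bound 0.
Proof.
move=> H w f _ cardH hf.
have all_w x : x = w.
  have /fintype1P[y ally] : #|H| == 1%N by rewrite cardH.
  by rewrite (ally x) (ally w).
rewrite (partition_big (fun phi : {ffun H -> G} => phi w) xpredT) //=.
apply: ler_sum => v _; rewrite expr0 mul1r.
under eq_bigr => phi /andP[_ /eqP ->] do [].
rewrite sumr_const -[leLHS]mulr_natl ler_piMl ?nneg_homo_ge0 // lern1.
apply/card_le1_eqP => phi1 phi2 /andP[_ /eqP e1] /andP[_ /eqP e2].
by apply/ffunP => x; rewrite (all_w x) e1 e2.
Qed.

Lemma all_weights_of_single n : single_weight_bound n -> all_weights_bound n.
Proof.
move=> single H F cH cardH hF.
have [w0 _] : exists w0 : H, w0 \in H by apply/card_gt0P; rewrite cardH.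
(* [N] exceeds every degree, so one finite range of thresholds serves all vertices; expanding the
   product then chooses a threshold [t w] for each [w]. *)
pose N := #|G|.+1.
have expand (e : H -> G) : \prod_w F w (deg (e w)) =
    \sum_(t : {ffun H -> 'I_N}) (\prod_w layer (F w) (t w)) *
       \prod_w (t w <= deg (e w))%N%:R.
  under eq_bigr do rewrite (layer_cake _ (deg_lt _)).
  by rewrite bigA_distr_bigA; apply: eq_bigr => t _; rewrite big_split.
under eq_bigr do rewrite expand.
under [leRHS]eq_bigr do rewrite (expand (fun=> _)) mulr_sumr.
rewrite exchange_big [leRHS]exchange_big; apply: ler_sum => t _ /=.
rewrite -mulr_sumr.
under [leRHS]eq_bigr do rewrite mulrCA.
rewrite -mulr_sumr ler_wpM2l ?prodr_ge0 // => [w _|]; first exact: layer_ge0.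
have [wm _ wm_max] := @arg_maxnP H w0 xpredT (fun w => t w : nat) isT.
apply: (@le_trans _ _
  (\sum_(phi in graph_hom H G) (t wm <= deg (phi wm))%N%:R)).
  apply: ler_sum => phi _; rewrite (bigD1 wm) //= ler_piMr ?ler0n //.
  by apply: prodr_ile1 => w _; rewrite ler0n lern1 leq_b1.
apply: le_trans (single H wm _ cH cardH (nneg_homo_leq (t wm))) _.
apply: ler_sum => v _; rewrite ler_wpM2l ?exprn_ge0 ?ler0n //.
(* On the right all indicators see the same degree, so passing the largest threshold means passing
   all of them. *)
case: leqP => [le_tv|_]; last by rewrite prodr_ge0.
rewrite big1 // => w _.
by rewrite (leq_trans (wm_max w isT) le_tv).
Qed.

Lemma single_weight_boundS n : all_weights_bound n -> single_weight_bound n.+1.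
Proof.
move=> all_n H w f cH cardH hf.
have H_gt1 : (1 < #|H|)%N by rewrite cardH.
have [l lw cD] := non_cut_vertex w cH H_gt1.
have wl : w != l by rewrite eq_sym.
have lS : l \in [set l] by rewrite set11.
have wNl : w \notin [set l] by rewrite inE.
(* An edge leaving the singleton of [l] provides a neighbour [p0] of [l]. *)
have [y [p0 [lp /set1P yl p0l]]] := boundary_edge cH lS wNl.
rewrite yl in lp; rewrite in_set1 in p0l.
pose w' : delete_vertex l := exist _ w wl.
pose p : delete_vertex l := exist _ p0 p0l.
pose g (psi : {ffun delete_vertex l -> G}) := f (deg (psi w')).
have g_ge0 psi : 0 <= g psi by exact: nneg_homo_ge0.
have := hom_sum_delete (p := p) lp g_ge0.
under eq_bigr do rewrite /g ffunE /=.
move=> le_del; apply: le_trans le_del _.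
(* Two separate factors, since [p] and [w'] may coincide. *)
pose F (x : delete_vertex l) (d : nat) : R :=
  (if x == w' then f d else 1) * (if x == p then d%:R else 1).
have hF x : nneg_homo (F x).
  apply: nneg_homo_mul; case: eqP => _ //; try exact: nneg_homo_cst1.
  exact: nneg_homo_natr.
have prodF (d : delete_vertex l -> nat) :
    \prod_x F x (d x) = f (d w') * (d p)%:R.
  by rewrite big_split -!big_mkcond !big_pred1_eq.
have cardD : #|delete_vertex l| = n.+1 by rewrite card_delete_vertex cardH.
have := all_n _ F cD cardD hF.
under eq_bigr do rewrite prodF.
move=> le_D; apply: le_trans le_D _; apply: ler_sum => v _.
by rewrite (prodF (fun=> deg v)) exprSr -mulrA [f _ * _]mulrC.
Qed.

Lemma hom_sum_le n : all_weights_bound n.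
Proof.
apply: all_weights_of_single.
elim: n => [|n IHn]; first exact: single_weight_bound0.
exact/single_weight_boundS/all_weights_of_single.
Qed.

End HomWeights.

(** * Real powers as weights *)

Lemma powRD_ge0 (R : realType) (x a b : R) :
  0 <= a -> 0 <= b -> x `^ (a + b) = x `^ a * x `^ b.
Proof.
(* At base 0 additivity can fail only for a zero sum of nonzero exponents; nonnegativity forces both
   exponents to be 0. *)
move=> a_ge0 b_ge0; have [/eqP|ab0] := eqVneq (a + b) 0.
  by rewrite paddr_eq0 // => /andP[/eqP -> /eqP ->]; rewrite addr0 powRr0 mulr1.
by rewrite powRD // (negbTE ab0).
Qed.

Lemma powR_sum_ge0 (R : realType) (I : finType) (x : R) (a : I -> R) :
  (forall i, 0 <= a i) -> x `^ (\sum_i a i) = \prod_i x `^ a i.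
Proof.
move=> a_ge0.
suff [] : 0 <= \sum_i a i /\ x `^ (\sum_i a i) = \prod_i x `^ a i by [].
elim/big_rec2: _ => [|i y s _ [s_ge0 IH]]; first by rewrite powRr0.
by rewrite powRD_ge0 // IH addr_ge0.
Qed.

Lemma nneg_homo_powR (R : realType) (a : R) :
  0 <= a -> nneg_homo (fun n => n%:R `^ a).
Proof.
move=> a_ge0; split=> [|m n le_mn]; first exact: powR_ge0.
by rewrite ge0_ler_powR // ?nnegrE ?ler0n // ler_nat.
Qed.

Theorem theorem3 (R : realType) (H : sgraph) (o : H) (G : sgraph)
    (Delta : R) (alpha : H -> R)
    (H_connected : connected_graph H)
    (Delta_ge0 : 0 <= Delta)
    (alpha_ge0 : forall w : H, 0 <= alpha w) :
  hom_weight o G Delta alpha <=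
  \sum_(v : G)
     (deg v)%:R `^ (#|H|%:R - 1 + \sum_(w : H) alpha w) *
     (Delta <= (deg v)%:R)%R%:R.
Proof.
have /card_gt0P/prednK/esym cardH : exists x : H, x \in H by exists o.
(* The indicator at the root is nondecreasing in the degree, so it is absorbed into the weight of
   [o]. *)
pose F (w : H) (d : nat) : R :=
  (if w == o then (Delta <= d%:R)%R%:R else 1) * d%:R `^ alpha w.
have hF w : nneg_homo (F w).
  apply: nneg_homo_mul; last exact: nneg_homo_powR.
  case: eqP => _; last exact: nneg_homo_cst1.
  split=> [|m n le_mn]; first exact: ler0n.
  rewrite ler_nat; case: (boolP (Delta <= m%:R)) => // le_Dm.
  by rewrite (le_trans le_Dm) // ler_nat.
have prodF (d : H -> nat) : \prod_w F w (d w) =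
    (Delta <= (d o)%:R)%R%:R * \prod_w (d w)%:R `^ alpha w.
  by rewrite big_split -big_mkcond big_pred1_eq.
have := hom_sum_le G H_connected cardH hF.
under eq_bigr do rewrite prodF.
move=> le_H; apply: le_trans le_H _; apply: ler_sum => v _.
rewrite (prodF (fun=> deg v)) mulrCA [leLHS]mulrC.
(* The root makes [#|H|] positive, so the truncated predecessor is the real difference. *)
have -> : #|H|%:R - 1 = #|H|.-1%:R :> R by rewrite {1}cardH -natr1 addrK.
by rewrite powRD_ge0 ?ler0n ?sumr_ge0 // powR_mulrn ?ler0n // powR_sum_ge0.
Qed.
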